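(* Let $\lambda,\delta\in\partial\mathbb D$, $a\in\mathbb D$, and $F=H+\overline G\in\mathcal F^a_{\lambda,\delta}$. If $F$ is locally one-to-one and sense-preserving on $\mathbb D$, then $F$ is a convex harmonic mapping, i.e. $F$ is univalent on $\mathbb D$ and $F(\mathbb D)$ is convex.
   Context: $\mathbb D$ is the open unit disk. $\mathcal H$ is the set of harmonic $f=h+\overline g$ on $\mathbb D$ ($h,g$ analytic) with $h(0)=g(0)=0$, $h'(0)=1$; $f$ is locally one-to-one and sense-preserving iff $|h'|>|g'|$ on $\mathbb D$. For $\lambda,\delta\in\partial\mathbb D$ and $a\in\mathbb D$, with $a'=|1+a|-1$ and $\gamma_a=\arg(1+\overline a)$, $\mathcal F^a_{\lambda,\delta}$ is the set of $F=H+\overline G\in\mathcal H$ with $H'(z)+\overline{\delta^2}e^{-2i\gamma_a}G'(z)=\frac{1+a'}{(1+\lambda\delta e^{i\gamma_a}z)(1+\overline\lambda\delta e^{i\gamma_a}z)}$ on $\mathbb D$. *)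

(* Defs.v *)
From Stdlib Require Import Reals.
Open Scope R_scope.

Definition Cx : Type := (R * R)%type.

Definition Cre (z : Cx) : R := fst z.
Definition Cim (z : Cx) : R := snd z.
Definition RtoC (x : R) : Cx := (x, 0).
Definition Czero : Cx := (0, 0).
Definition Cone : Cx := (1, 0).
Definition Cadd (z w : Cx) : Cx := (fst z + fst w, snd z + snd w).
Definition Copp (z : Cx) : Cx := (- fst z, - snd z).
Definition Csub (z w : Cx) : Cx := Cadd z (Copp w).
Definition Cmul (z w : Cx) : Cx :=
  (fst z * fst w - snd z * snd w, fst z * snd w + snd z * fst w).
Definition Cconj (z : Cx) : Cx := (fst z, - snd z).
Definition Cnorm (z : Cx) : R := sqrt (fst z ^ 2 + snd z ^ 2).
Definition Cinv (z : Cx) : Cx :=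
  (fst z / (fst z ^ 2 + snd z ^ 2), - snd z / (fst z ^ 2 + snd z ^ 2)).
Definition Cdiv (z w : Cx) : Cx := Cmul z (Cinv w).
Definition Cexpi (t : R) : Cx := (cos t, sin t).
Definition Cscale (t : R) (z : Cx) : Cx := (t * fst z, t * snd z).

Definition in_disk (z : Cx) : Prop := Cnorm z < 1.
Definition on_circle (z : Cx) : Prop := Cnorm z = 1.

Definition is_arg (w : Cx) (gamma : R) : Prop :=
  Cnorm w * cos gamma = fst w /\ Cnorm w * sin gamma = snd w.

Definition has_cderiv (f : Cx -> Cx) (z l : Cx) : Prop :=
  forall eps : R, 0 < eps -> exists del : R, 0 < del /\
    forall w : Cx, Cnorm (Csub w z) < del ->
      Cnorm (Csub (Csub (f w) (f z)) (Cmul l (Csub w z)))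
        <= eps * Cnorm (Csub w z).

Definition analytic_on_disk (f f' : Cx -> Cx) : Prop :=
  forall z : Cx, in_disk z -> has_cderiv f z (f' z).

Definition harm (h g : Cx -> Cx) : Cx -> Cx := fun z => Cadd (h z) (Cconj (g z)).

Definition in_classH (h h' g g' : Cx -> Cx) : Prop :=
  analytic_on_disk h h' /\ analytic_on_disk g g' /\
  h Czero = Czero /\ g Czero = Czero /\ h' Czero = Cone.

(* membership in F^a_{lambda,delta}; gamma = gamma_a = arg (1 + conj a),
   a' = |1+a| - 1 *)
Definition in_classF (lam del a : Cx) (gamma : R) (h h' g g' : Cx -> Cx) : Prop :=
  in_classH h h' g g' /\
  forall z : Cx, in_disk z ->
    Cadd (h' z)
         (Cmul (Cmul (Cmul (Cconj del) (Cconj del)) (Cexpi (-2 * gamma))) (g' z))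
    = Cdiv (RtoC (1 + (Cnorm (Cadd Cone a) - 1)))
           (Cmul (Cadd Cone (Cmul (Cmul (Cmul lam del) (Cexpi gamma)) z))
                 (Cadd Cone (Cmul (Cmul (Cmul (Cconj lam) del) (Cexpi gamma)) z))).

(* locally one-to-one and sense-preserving: |h'| > |g'| on D *)
Definition sense_preserving (h' g' : Cx -> Cx) : Prop :=
  forall z : Cx, in_disk z -> Cnorm (g' z) < Cnorm (h' z).

Definition univalent_on_disk (F : Cx -> Cx) : Prop :=
  forall z w : Cx, in_disk z -> in_disk w -> F z = F w -> z = w.

Definition convex_image (F : Cx -> Cx) : Prop :=
  forall z w : Cx, in_disk z -> in_disk w -> forall t : R, 0 <= t <= 1 ->
    exists u : Cx, in_disk u /\
      F u = Cadd (Cscale (1 - t) (F z)) (Cscale t (F w)).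

(* Main.v *)
(* Put [b = del e^(i gamma)]. Then [b F = Re p + i Im q] with [p = b h + conj b g] and
   [q = b h - conj b g], and the hypothesis makes [p] an explicit univalent map of the disk onto
   a vertical strip or half-plane. In the coordinate [p = x + iy], [q] has derivative
   [(b h' - conj b g') / (b h' + conj b g')], of positive real part since [|g'| < |h'|], and
   [b F = x + i V(x, y)] with [V = Im q] strictly increasing in [y]. So [F] is univalent and
   the image of [b F] meets each vertical line of the strip in an interval; convexity amounts to
   [sup_y V(x, y)] being concave and [inf_y V(x, y)] convex in [x], which follows from
   Cauchy's theorem on rectangles and the monotonicity of [Re q] in [x]. *)

Require Import Defs.
From Stdlib Require Import Reals Lra.
From Coquelicot Require Import Coquelicot.
Open Scope R_scope.

(** The derivative is assumed to exist at every point, but not to be continuous. Green's formula and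
    differentiation under the integral sign would need that continuity, so Cauchy's theorem is
    obtained by Goursat's bisection, and the concavity argument integrates only [q] itself, never
    its derivative. [V] is strictly increasing in [y], so its supremum on a vertical line is never
    attained, and it may be infinite. Concavity is therefore phrased with witnesses: for any heights
    over two abscissas, some height over the intermediate abscissa has a value of [V] at least the
    weighted mean. The same form serves for the infimum, and an intermediate value argument joins
    the two. The strip is parametrised by the inverse [k] of the explicit univalent map. This
    inverse is a Moebius transformation of the identity or of an exponential, so no branch of the
    logarithm has to be chosen. *)

Lemma has_cderivE (f : C -> C) (z l : C) :
  has_cderiv f z l <->
  forall eps : R, 0 < eps -> exists del : R, 0 < del /\
    forall w : C, Cmod (w - z) < del ->
      Cmod ((f w - f z) - l * (w - z)) <= eps * Cmod (w - z).
(* [Cx] and [C] are the same pairs, and [Cnorm], [Csub], [Cmul] unfold to the operations of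
   Coquelicot. This gives access to [ring] and [field] on complex numbers. *)
Proof. reflexivity. Qed.

(** * Rules of complex differentiation *)

Lemma has_cderiv_ext (f f' : C -> C) (z l l' : C) :
  (forall w, f w = f' w) -> l = l' -> has_cderiv f z l -> has_cderiv f' z l'.
Proof.
intros Hf <- H; apply has_cderivE; intros eps He.
destruct (proj1 (has_cderivE _ _ _) H eps He) as [d [Hd Hw]].
exists d; split; trivial; intros w; rewrite <- !Hf; apply Hw.
Qed.

Lemma has_cderiv_id (z : C) : has_cderiv (fun w => w) z (RtoC 1).
Proof.
apply has_cderivE; intros eps He; exists 1; split; [lra|]; intros w _.
replace (w - z - 1 * (w - z))%C with (RtoC 0) by ring.
rewrite Cmod_0; apply Rmult_le_pos; [lra|apply Cmod_ge_0].
Qed.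

Lemma has_cderiv_const (c z : C) : has_cderiv (fun _ => c) z (RtoC 0).
Proof.
apply has_cderivE; intros eps He; exists 1; split; [lra|]; intros w _.
replace (c - c - 0 * (w - z))%C with (RtoC 0) by ring.
rewrite Cmod_0; apply Rmult_le_pos; [lra|apply Cmod_ge_0].
Qed.

Lemma has_cderiv_plus (f g : C -> C) (z l m : C) :
  has_cderiv f z l -> has_cderiv g z m ->
  has_cderiv (fun w => (f w + g w)%C) z (l + m)%C.
Proof.
intros Hf Hg; apply has_cderivE; intros eps He.
destruct (proj1 (has_cderivE _ _ _) Hf (eps / 2)) as [d1 [Hd1 H1]]; [lra|].
destruct (proj1 (has_cderivE _ _ _) Hg (eps / 2)) as [d2 [Hd2 H2]]; [lra|].
exists (Rmin d1 d2); split; [now apply Rmin_pos|]; intros w Hw.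
specialize (H1 w (Rlt_le_trans _ _ _ Hw (Rmin_l _ _))).
specialize (H2 w (Rlt_le_trans _ _ _ Hw (Rmin_r _ _))).
replace (f w + g w - (f z + g z) - (l + m) * (w - z))%C
  with ((f w - f z - l * (w - z)) + (g w - g z - m * (w - z)))%C by ring.
eapply Rle_trans; [apply Cmod_triangle|lra].
Qed.

Lemma has_cderiv_comp (f k : C -> C) (z l m : C) :
  has_cderiv f (k z) l -> has_cderiv k z m ->
  has_cderiv (fun w => f (k w)) z (l * m)%C.
Proof.
intros Hf Hk; apply has_cderivE; intros eps He.
pose proof (Cmod_ge_0 l) as Hl; pose proof (Cmod_ge_0 m) as Hm.
(* [e2 <= 1] makes [k] Lipschitz at [z] with constant [Cmod m + 1], which [e1] compensates; the
   second bound in [e2] compensates the factor [Cmod l]. The added 1 keeps both divisors nonzero. *)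
set (e1 := eps / 2 / (Cmod m + 1)).
set (e2 := Rmin 1 (eps / 2 / (Cmod l + 1))).
assert (He1 : 0 < e1) by (apply Rdiv_lt_0_compat; lra).
assert (He2' : 0 < eps / 2 / (Cmod l + 1)) by (apply Rdiv_lt_0_compat; lra).
assert (He2 : 0 < e2) by (apply Rmin_pos; lra).
assert (E1 : e1 * (Cmod m + 1) = eps / 2) by (unfold e1; field; lra).
assert (E2 : eps / 2 / (Cmod l + 1) * (Cmod l + 1) = eps / 2) by (field; lra).
assert (e2 <= 1) by apply Rmin_l.
assert (e2 <= eps / 2 / (Cmod l + 1)) by apply Rmin_r.
destruct (proj1 (has_cderivE _ _ _) Hf e1 He1) as [d1 [Hd1 H1]].
destruct (proj1 (has_cderivE _ _ _) Hk e2 He2) as [d2 [Hd2 H2]].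
assert (Hd3 : 0 < d1 / (Cmod m + 1)) by (apply Rdiv_lt_0_compat; lra).
assert (E3 : d1 / (Cmod m + 1) * (Cmod m + 1) = d1) by (field; lra).
exists (Rmin d2 (d1 / (Cmod m + 1))); split; [now apply Rmin_pos|]; intros w Hw.
specialize (H2 w (Rlt_le_trans _ _ _ Hw (Rmin_l _ _))).
pose proof (Rlt_le_trans _ _ _ Hw (Rmin_r _ _)) as Hw'.
pose proof (Cmod_ge_0 (w - z)) as Hwz.
assert (Hk' : Cmod (k w - k z) <= (Cmod m + 1) * Cmod (w - z)).
{ replace (k w - k z)%C with ((k w - k z - m * (w - z)) + m * (w - z))%C by ring.
  eapply Rle_trans; [apply Cmod_triangle|]; rewrite Cmod_mult; nra. }
assert (Hd : Cmod (k w - k z) < d1) by nra.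
specialize (H1 _ Hd).
replace (f (k w) - f (k z) - l * m * (w - z))%C
  with ((f (k w) - f (k z) - l * (k w - k z)) + l * (k w - k z - m * (w - z)))%C by ring.
eapply Rle_trans; [apply Cmod_triangle|]; rewrite Cmod_mult.
assert (A1 : e1 * Cmod (k w - k z) <= eps / 2 * Cmod (w - z)).
{ rewrite <- E1, Rmult_assoc; apply Rmult_le_compat_l; lra. }
assert (A2 : Cmod l * Cmod (k w - k z - m * (w - z)) <= eps / 2 * Cmod (w - z)).
{ apply Rle_trans with ((Cmod l + 1) * (eps / 2 / (Cmod l + 1) * Cmod (w - z))).
  - apply Rmult_le_compat; try lra; try apply Cmod_ge_0.
    eapply Rle_trans; [apply H2|apply Rmult_le_compat_r; lra].
  - rewrite <- Rmult_assoc, (Rmult_comm (Cmod l + 1)), E2; lra. }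
lra.
Qed.

Lemma has_cderiv_scal (a : C) (f : C -> C) (z l : C) :
  has_cderiv f z l -> has_cderiv (fun w => (a * f w)%C) z (a * l)%C.
Proof.
intros Hf; apply (has_cderiv_comp (fun w => (a * w)%C)); [|exact Hf].
apply has_cderivE; intros eps He; exists 1; split; [lra|]; intros w _.
replace (a * w - a * f z - a * (w - f z))%C with (RtoC 0) by ring.
rewrite Cmod_0; apply Rmult_le_pos; [lra|apply Cmod_ge_0].
Qed.

Lemma has_cderiv_inv (z : C) :
  z <> RtoC 0 -> has_cderiv (fun w => (/ w)%C) z (- (/ (z * z)))%C.
Proof.
intros Hz; apply has_cderivE; intros eps He.
pose proof (proj1 (Cmod_gt_0 z) Hz) as Hp.
set (r := Cmod z) in *.
(* The remainder is $(w-z)^2/(wz^2)$. The first radius gives $|w|>r/2$, so the denominator exceeds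
   $r^3/2$ in modulus; the second cancels exactly this bound. *)
exists (Rmin (r / 2) (eps * (r * r * r) / 2)); split.
{ apply Rmin_pos; [lra|]. apply Rdiv_lt_0_compat; [|lra].
  repeat apply Rmult_lt_0_compat; lra. }
intros w Hw.
pose proof (Rlt_le_trans _ _ _ Hw (Rmin_l _ _)) as Hw1.
pose proof (Rlt_le_trans _ _ _ Hw (Rmin_r _ _)) as Hw2.
assert (Hwr : r / 2 < Cmod w).
{ assert (T := Cmod_triangle w (- (w - z))); rewrite Cmod_opp in T.
  replace (w + - (w - z))%C with z in T by ring. fold r in T; lra. }
assert (Hw0 : w <> RtoC 0) by (apply Cmod_gt_0; lra).
replace (/ w - / z - - / (z * z) * (w - z))%C
  with ((w - z) * (w - z) * / (w * (z * z)))%C by (field; split; auto).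
rewrite !Cmod_mult, Cmod_inv by (repeat apply Cmult_neq_0; auto).
rewrite !Cmod_mult; fold r.
pose proof (Cmod_ge_0 (w - z)).
assert (0 < r * r) by nra.
apply Rle_trans with (Cmod (w - z) * (eps * (r * r * r) / 2) * / (r / 2 * (r * r))).
- apply Rmult_le_compat.
  + nra.
  + left; apply Rinv_0_lt_compat; nra.
  + apply Rmult_le_compat_l; lra.
  + apply Rinv_le_contravar; [nra|]. apply Rmult_le_compat_r; lra.
- right; field; lra.
Qed.

(** This is $e^{iw}$. The factor $i$ suits vertical strips: the abscissa becomes the argument and
    the ordinate governs the modulus. *)
Definition cexpi (w : C) : C :=
  (exp (- snd w) * cos (fst w), exp (- snd w) * sin (fst w)).

Lemma cexpi_plus (z w : C) : cexpi (z + w) = (cexpi z * cexpi w)%C.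
Proof.
unfold cexpi, Cmult; simpl.
rewrite Ropp_plus_distr, exp_plus, cos_plus, sin_plus.
apply injective_projections; simpl; ring.
Qed.

Lemma Cmod_le_Rabs (z : C) : Cmod z <= Rabs (fst z) + Rabs (snd z).
Proof.
pose proof (Rabs_pos (fst z)); pose proof (Rabs_pos (snd z)).
unfold Cmod; rewrite <- (sqrt_pow2 (Rabs (fst z) + Rabs (snd z))) by lra.
apply sqrt_le_1_alt; rewrite <- (pow2_abs (fst z)), <- (pow2_abs (snd z)); nra.
Qed.

Lemma Cmod_fst (z : C) : Rabs (fst z) <= Cmod z.
Proof. eapply Rle_trans; [apply Rmax_l|apply Rmax_Cmod]. Qed.

Lemma Cmod_snd (z : C) : Rabs (snd z) <= Cmod z.
Proof. eapply Rle_trans; [apply Rmax_r|apply Rmax_Cmod]. Qed.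

(** At 0 the claim reduces to the real derivatives of [exp], [cos] and [sin]; the functional
    equation [cexpi_plus] carries it to any other point. *)
Lemma has_cderiv_cexpi (z : C) : has_cderiv cexpi z (cexpi z * Ci)%C.
Proof.
assert (H0 : has_cderiv cexpi (RtoC 0) Ci).
{ apply has_cderivE; intros eps He.
  (* The real and imaginary parts of the remainder are bounded below by [3 * (e * m)] and
     [5 * (e * m)] respectively as upper estimates, which add up to [8 * (e * m)]. *)
  set (e := Rmin 1 (eps / 8)).
  assert (He0 : 0 < e) by (apply Rmin_pos; lra).
  assert (He1 : e <= 1) by apply Rmin_l.
  assert (He2 : e <= eps / 8) by apply Rmin_r.
  destruct (derivable_pt_lim_exp 0 e He0) as [d1 H1].
  destruct (derivable_pt_lim_cos 0 e He0) as [d2 H2].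
  destruct (derivable_pt_lim_sin 0 e He0) as [d3 H3].
  assert (L : forall f l d, (forall h, h <> 0 -> Rabs h < d ->
     Rabs ((f (0 + h) - f 0) / h - l) < e) ->
     forall h, Rabs h < d -> Rabs (f h - f 0 - l * h) <= e * Rabs h).
  { intros f l d H h Hh. destruct (Req_dec h 0) as [->|Hn].
    - replace (f 0 - f 0 - l * 0) with 0 by ring. rewrite Rabs_R0; lra.
    - specialize (H h Hn Hh). rewrite Rplus_0_l in H.
      replace (f h - f 0 - l * h) with (((f h - f 0) / h - l) * h) by (now field).
      rewrite Rabs_mult; apply Rmult_le_compat_r; [apply Rabs_pos|lra]. }
  pose proof (L _ _ _ H1) as L1; pose proof (L _ _ _ H2) as L2.
  pose proof (L _ _ _ H3) as L3; clear L H1 H2 H3.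
  rewrite exp_0 in L1; rewrite cos_0, sin_0 in L2; rewrite cos_0, sin_0 in L3.
  exists (Rmin (e / 2) (Rmin d1 (Rmin d2 d3))); split.
  { repeat apply Rmin_pos; try apply cond_pos; lra. }
  intros [x y] Hw.
  replace ((x, y) - 0)%C with ((x, y) : C) in *
    by (apply injective_projections; simpl; ring).
  set (m := Cmod (x, y)) in *.
  assert (Hm : m < e / 2 /\ m < d1 /\ m < d2 /\ m < d3).
  { pose proof (Rmin_l (e / 2) (Rmin d1 (Rmin d2 d3))).
    pose proof (Rmin_r (e / 2) (Rmin d1 (Rmin d2 d3))).
    pose proof (Rmin_l d1 (Rmin d2 d3)); pose proof (Rmin_r d1 (Rmin d2 d3)).
    pose proof (Rmin_l d2 d3); pose proof (Rmin_r d2 d3). lra. }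
  pose proof (Cmod_fst (x, y)) as Hx; pose proof (Cmod_snd (x, y)) as Hy.
  fold m in Hx, Hy; simpl in Hx, Hy.
  assert (Hx0 := Rabs_pos x); assert (Hy0 := Rabs_pos y).
  specialize (L1 (- y)); specialize (L2 x); specialize (L3 x).
  rewrite Rabs_Ropp in L1.
  specialize (L1 ltac:(lra)); specialize (L2 ltac:(lra)); specialize (L3 ltac:(lra)).
  eapply Rle_trans; [apply Cmod_le_Rabs|].
  unfold cexpi; simpl.
  rewrite Ropp_0, exp_0, cos_0, sin_0.
  replace (exp (- y) * cos x + - (1 * 1) + - (0 * x - 1 * y))
    with ((exp (- y) - 1 - 1 * - y) * cos x + (1 - y) * (cos x - 1 - (- 0) * x)) by ring.
  replace (exp (- y) * sin x + - (1 * 0) + - (0 * y + 1 * x))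
    with (exp (- y) * (sin x - 0 - 1 * x) + x * (exp (- y) - 1)) by ring.
  set (A := exp (- y) - 1 - 1 * - y) in *. set (B := cos x - 1 - - 0 * x) in *.
  set (D := sin x - 0 - 1 * x) in *.
  assert (Hc : Rabs (cos x) <= 1) by (apply Rabs_le, COS_bound).
  assert (Hy1 : Rabs (1 - y) <= 2).
  { eapply Rle_trans; [apply Rabs_triang|]. rewrite Rabs_R1, Rabs_Ropp; lra. }
  assert (HE : Rabs (exp (- y) - 1) <= 2 * e).
  { replace (exp (- y) - 1) with (A - y) by (unfold A; ring).
    eapply Rle_trans; [apply Rabs_triang|]; rewrite Rabs_Ropp; nra. }
  assert (HE2 : Rabs (exp (- y)) <= 3).
  { replace (exp (- y)) with ((exp (- y) - 1) + 1) by ring.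
    eapply Rle_trans; [apply Rabs_triang|]. rewrite Rabs_R1; lra. }
  assert (HA : Rabs A <= e * m) by nra.
  assert (HB : Rabs B <= e * m) by nra.
  assert (HD : Rabs D <= e * m) by nra.
  assert (Rabs (A * cos x + (1 - y) * B) <= 3 * (e * m)).
  { eapply Rle_trans; [apply Rabs_triang|]. rewrite !Rabs_mult.
    pose proof (Rabs_pos A); pose proof (Rabs_pos B).
    pose proof (Rabs_pos (cos x)); pose proof (Rabs_pos (1 - y)). nra. }
  assert (Rabs (exp (- y) * D + x * (exp (- y) - 1)) <= 5 * (e * m)).
  { eapply Rle_trans; [apply Rabs_triang|]. rewrite !Rabs_mult.
    pose proof (Rabs_pos D); pose proof (Rabs_pos (exp (- y) - 1)).
    pose proof (Rabs_pos (exp (- y))). nra. }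
  nra. }
apply has_cderiv_ext with (fun w => (cexpi z * cexpi (1 * w + - z))%C) (cexpi z * (Ci * (1 * 1 + 0)))%C.
- intros w; rewrite <- cexpi_plus; f_equal; ring.
- ring.
- apply has_cderiv_scal, (has_cderiv_comp cexpi).
  + replace (1 * z + - z)%C with (RtoC 0) by ring; exact H0.
  + apply has_cderiv_plus; [apply has_cderiv_scal, has_cderiv_id|apply has_cderiv_const].
Qed.

Lemma is_derive_along (f : C -> C) (z d l : C) (t : R) :
  has_cderiv f (z + RtoC t * d)%C l ->
  is_derive (fun s => fst (f (z + RtoC s * d)%C)) t (fst (l * d)%C) /\
  is_derive (fun s => snd (f (z + RtoC s * d)%C)) t (snd (l * d)%C).
Proof.
intros H.
(* Half of [eps] is used because the real derivative asks for a strict inequality, while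
   [has_cderiv] gives a weak one. *)
assert (G : forall eps, 0 < eps -> exists delta, 0 < delta /\ forall h, h <> 0 ->
   Rabs h < delta ->
   Cmod (f (z + RtoC (t + h) * d)%C - f (z + RtoC t * d)%C - l * d * RtoC h)
     <= eps / 2 * Rabs h).
{ intros eps He. pose proof (Cmod_ge_0 d) as Hd.
  assert (He' : 0 < eps / 2 / (Cmod d + 1)) by (apply Rdiv_lt_0_compat; lra).
  destruct (proj1 (has_cderivE _ _ _) H _ He') as [r [Hr Hw]].
  exists (r / (Cmod d + 1)); split; [apply Rdiv_lt_0_compat; lra|].
  intros h _ Hh.
  assert (E : (z + RtoC (t + h) * d - (z + RtoC t * d) = RtoC h * d)%C)
    by (rewrite RtoC_plus; ring).
  specialize (Hw (z + RtoC (t + h) * d)%C); rewrite E in Hw.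
  rewrite Cmod_mult, Cmod_R in Hw.
  assert (E3 : r / (Cmod d + 1) * (Cmod d + 1) = r) by (field; lra).
  assert (E4 : eps / 2 / (Cmod d + 1) * (Cmod d + 1) = eps / 2) by (field; lra).
  pose proof (Rabs_pos h).
  assert (Hhd : Rabs h * Cmod d < r).
  { apply Rle_lt_trans with (Rabs h * (Cmod d + 1)); [nra|].
    rewrite <- E3; apply Rmult_lt_compat_r; lra. }
  specialize (Hw Hhd).
  replace (l * d * RtoC h)%C with (l * (RtoC h * d))%C by ring.
  eapply Rle_trans; [apply Hw|].
  set (u := eps / 2 / (Cmod d + 1)) in *.
  assert (0 <= u * Rabs h) by (apply Rmult_le_pos; lra).
  rewrite <- E4; lra. }
assert (F : forall x h e : R, h <> 0 -> 0 < e -> Rabs x <= e / 2 * Rabs h -> Rabs (x / h) < e).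
{ intros x h e Hh He Hx. unfold Rdiv; rewrite Rabs_mult, Rabs_inv.
  pose proof (Rabs_pos_lt h Hh) as Hp.
  apply Rle_lt_trans with (e / 2 * Rabs h * / Rabs h).
  - apply Rmult_le_compat_r; [left; now apply Rinv_0_lt_compat|exact Hx].
  - rewrite Rmult_assoc, Rinv_r; lra. }
split; apply is_derive_Reals; intros eps He;
  destruct (G eps He) as [r [Hr Hw]]; exists (mkposreal r Hr); intros h Hh Hhr;
  specialize (Hw h Hh Hhr).
- pose proof (Rle_trans _ _ _ (Cmod_fst _) Hw) as A.
  replace ((fst (f (z + RtoC (t + h) * d)%C) - fst (f (z + RtoC t * d)%C)) / h - fst (l * d)%C)
    with (fst (f (z + RtoC (t + h) * d)%C - f (z + RtoC t * d)%C - l * d * RtoC h)%C / h).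
  + now apply F.
  + simpl; field; exact Hh.
- pose proof (Rle_trans _ _ _ (Cmod_snd _) Hw) as A.
  replace ((snd (f (z + RtoC (t + h) * d)%C) - snd (f (z + RtoC t * d)%C)) / h - snd (l * d)%C)
    with (snd (f (z + RtoC (t + h) * d)%C - f (z + RtoC t * d)%C - l * d * RtoC h)%C / h).
  + now apply F.
  + simpl; field; exact Hh.
Qed.

Lemma is_derive_Re_horizontal (f : C -> C) (x y : R) (l : C) :
  has_cderiv f (x, y) l -> is_derive (fun s => fst (f (s, y))) x (fst l).
Proof.
intros H.
assert (E : forall s, ((0, y) + RtoC s * (1, 0))%C = ((s, y) : C))
  by (intros s; apply injective_projections; simpl; ring).
rewrite <- E in H; apply is_derive_along in H; destruct H as [H _].
replace (fst l) with (fst (l * (1, 0))%C) by (simpl; ring).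
revert H; apply is_derive_ext; intros s; now rewrite E.
Qed.

(** Together with the previous lemma this is the Cauchy-Riemann equation $U_x=V_y=\mathrm{Re}\,f'$.
    A positive real part of the derivative thus makes $U$ increase in $x$ and $V$ increase in
    $y$. *)
Lemma is_derive_Im_vertical (f : C -> C) (x y : R) (l : C) :
  has_cderiv f (x, y) l -> is_derive (fun s => snd (f (x, s))) y (fst l).
Proof.
intros H.
assert (E : forall s, ((x, 0) + RtoC s * (0, 1))%C = ((x, s) : C))
  by (intros s; apply injective_projections; simpl; ring).
rewrite <- E in H; apply is_derive_along in H; destruct H as [_ H].
replace (fst l) with (snd (l * (0, 1))%C) by (simpl; ring).
revert H; apply is_derive_ext; intros s; now rewrite E.
Qed.

(** * Cauchy's theorem on rectangles *)

(* Minus the real part of the contour integral of [q] along the boundary of the rectangle. *)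
Definition circ (q : C -> C) (x1 x2 y1 y2 : R) : R :=
  RInt (fun y => snd (q (x2, y))) y1 y2 - RInt (fun y => snd (q (x1, y))) y1 y2
  + RInt (fun x => fst (q (x, y2))) x1 x2 - RInt (fun x => fst (q (x, y1))) x1 x2.

Definition diff_on_rect (q : C -> C) (x1 x2 y1 y2 : R) : Prop :=
  forall x y, x1 <= x <= x2 -> y1 <= y <= y2 -> exists l : C, has_cderiv q (x, y) l.

Lemma ex_RInt_vertical (q : C -> C) (x1 x2 y1 y2 x a b : R) :
  diff_on_rect q x1 x2 y1 y2 -> x1 <= x <= x2 -> y1 <= a <= b -> b <= y2 ->
  ex_RInt (fun y => snd (q (x, y))) a b.
Proof.
intros Hq Hx Ha Hb; apply (ex_RInt_continuous (V := R_CompleteNormedModule)); intros t.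
rewrite Rmin_left, Rmax_right by lra; intros Ht.
destruct (Hq x t) as [l Hl]; [lra|lra|].
apply (@ex_derive_continuous R_AbsRing R_NormedModule); eexists; exact (is_derive_Im_vertical _ _ _ _ Hl).
Qed.

Lemma ex_RInt_horizontal (q : C -> C) (x1 x2 y1 y2 y a b : R) :
  diff_on_rect q x1 x2 y1 y2 -> y1 <= y <= y2 -> x1 <= a <= b -> b <= x2 ->
  ex_RInt (fun x => fst (q (x, y))) a b.
Proof.
intros Hq Hx Ha Hb; apply (ex_RInt_continuous (V := R_CompleteNormedModule)); intros t.
rewrite Rmin_left, Rmax_right by lra; intros Ht.
destruct (Hq t y) as [l Hl]; [lra|lra|].
apply (@ex_derive_continuous R_AbsRing R_NormedModule); eexists; exact (is_derive_Re_horizontal _ _ _ _ Hl).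
Qed.

Lemma circ_split_horizontal (q : C -> C) (x1 m x2 y1 y2 : R) :
  diff_on_rect q x1 x2 y1 y2 -> x1 <= m <= x2 -> y1 <= y2 ->
  circ q x1 x2 y1 y2 = circ q x1 m y1 y2 + circ q m x2 y1 y2.
Proof.
intros Hq Hm Hy; unfold circ.
rewrite <- (RInt_Chasles (fun x => fst (q (x, y1))) x1 m x2),
  <- (RInt_Chasles (fun x => fst (q (x, y2))) x1 m x2)
  by (apply (ex_RInt_horizontal q x1 x2 y1 y2); trivial; lra).
unfold plus; simpl; ring.
Qed.

Lemma circ_split_vertical (q : C -> C) (x1 x2 y1 m y2 : R) :
  diff_on_rect q x1 x2 y1 y2 -> y1 <= m <= y2 -> x1 <= x2 ->
  circ q x1 x2 y1 y2 = circ q x1 x2 y1 m + circ q x1 x2 m y2.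
Proof.
intros Hq Hm Hy; unfold circ.
rewrite <- (RInt_Chasles (fun y => snd (q (x1, y))) y1 m y2),
  <- (RInt_Chasles (fun y => snd (q (x2, y))) y1 m y2)
  by (apply (ex_RInt_vertical q x1 x2 y1 y2); trivial; lra).
unfold plus; simpl; ring.
Qed.

(** An affine function has no circulation. Here this appears by pairing opposite edges: the affine
    part contributes [snd l] times the area to the vertical pair and the opposite amount to the
    horizontal pair, and in each pair a remainder of at most [2 * e] is integrated. *)
Lemma circ_estimate (q : C -> C) (x1 x2 y1 y2 : R) (w l : C) (e : R) :
  diff_on_rect q x1 x2 y1 y2 -> x1 <= x2 -> y1 <= y2 ->
  (forall x y, x1 <= x <= x2 -> y1 <= y <= y2 ->
     Cmod ((q (x, y) - q w) - l * ((x, y) - w)) <= e) ->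
  Rabs (circ q x1 x2 y1 y2) <= 2 * e * ((x2 - x1) + (y2 - y1)).
Proof.
intros Hq Hx Hy He.
assert (V : forall x, x1 <= x <= x2 -> ex_RInt (fun y => snd (q (x, y))) y1 y2)
  by (intros x H; apply (ex_RInt_vertical q x1 x2 y1 y2); trivial; lra).
assert (U : forall y, y1 <= y <= y2 -> ex_RInt (fun x => fst (q (x, y))) x1 x2)
  by (intros y H; apply (ex_RInt_horizontal q x1 x2 y1 y2); trivial; lra).
assert (A : Rabs (RInt (fun y => (snd (q (x2, y)) - snd (q (x1, y))) - snd l * (x2 - x1)) y1 y2)
   <= (y2 - y1) * (2 * e)).
{ apply abs_RInt_le_const; trivial.
  - apply (ex_RInt_minus (V := R_NormedModule)); [|apply ex_RInt_const].
    apply (ex_RInt_minus (V := R_NormedModule)); apply V; lra.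
  - intros y Hyy.
    pose proof (Rle_trans _ _ _ (Cmod_snd _) (He x2 y ltac:(lra) ltac:(lra))) as H2.
    pose proof (Rle_trans _ _ _ (Cmod_snd _) (He x1 y ltac:(lra) ltac:(lra))) as H1.
    simpl in H1, H2.
    match type of H2 with Rabs ?a <= _ => match type of H1 with Rabs ?b <= _ =>
      replace (snd (q (x2, y)) - snd (q (x1, y)) - snd l * (x2 - x1)) with (a - b) by ring;
      pose proof (Rabs_triang a (- b)) as T; rewrite Rabs_Ropp in T end end.
    unfold Rminus in *; lra. }
assert (B : Rabs (RInt (fun x => (fst (q (x, y2)) - fst (q (x, y1))) - - snd l * (y2 - y1)) x1 x2)
   <= (x2 - x1) * (2 * e)).
{ apply abs_RInt_le_const; trivial.
  - apply (ex_RInt_minus (V := R_NormedModule)); [|apply ex_RInt_const].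
    apply (ex_RInt_minus (V := R_NormedModule)); apply U; lra.
  - intros x Hxx.
    pose proof (Rle_trans _ _ _ (Cmod_fst _) (He x y2 ltac:(lra) ltac:(lra))) as H2.
    pose proof (Rle_trans _ _ _ (Cmod_fst _) (He x y1 ltac:(lra) ltac:(lra))) as H1.
    simpl in H1, H2.
    match type of H2 with Rabs ?a <= _ => match type of H1 with Rabs ?b <= _ =>
      replace (fst (q (x, y2)) - fst (q (x, y1)) - - snd l * (y2 - y1)) with (a - b) by ring;
      pose proof (Rabs_triang a (- b)) as T; rewrite Rabs_Ropp in T end end.
    unfold Rminus in *; lra. }
assert (M : forall (f g : R -> R) (c a b : R), ex_RInt f a b -> ex_RInt g a b ->
  RInt (fun x => f x - g x - c) a b = RInt f a b - RInt g a b - (b - a) * c).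
{ intros f g c a b Hf Hg; apply is_RInt_unique.
  apply (is_RInt_minus (V := R_NormedModule)); [|apply (is_RInt_const (V := R_NormedModule))].
  apply (is_RInt_minus (V := R_NormedModule));
    now apply (RInt_correct (V := R_CompleteNormedModule)). }
rewrite M in A by (apply V; lra); rewrite M in B by (apply U; lra).
unfold circ.
match type of A with Rabs ?a <= _ => match type of B with Rabs ?b <= _ =>
  match goal with |- Rabs ?c <= _ => replace c with (a + b) by ring end;
  pose proof (Rabs_triang a b) end end.
lra.
Qed.

(** * Goursat's bisection argument *)

Section Bisection.

Variables (q : C -> C) (x1 y1 a b : R).
Hypotheses (Ha : 0 <= a) (Hb : 0 <= b).
Hypothesis (Hq : diff_on_rect q x1 (x1 + a) y1 (y1 + b)).

Let half (n : nat) : R := / 2 ^ n.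

Let circ_at (n : nat) (p : R * R) : R :=
  Rabs (circ q (fst p) (fst p + a * half n) (snd p) (snd p + b * half n)).

(* Lower left corner of a quarter with at least a fourth of the circulation. *)
Fixpoint corner (n : nat) : R * R :=
  match n with
  | O => (x1, y1)
  | S m =>
      let p := corner m in
      let px := fst p + a * half n in
      let py := snd p + b * half n in
      if Rle_dec (circ_at m p / 4) (circ_at n p) then p else
      if Rle_dec (circ_at m p / 4) (circ_at n (px, snd p)) then (px, snd p) else
      if Rle_dec (circ_at m p / 4) (circ_at n (fst p, py)) then (fst p, py) else (px, py)
  end.

Lemma half_S n : half n = 2 * half (S n).
Proof. unfold half; simpl; field; apply pow_nonzero; lra. Qed.

Lemma half_pos n : 0 < half n.
Proof. unfold half; apply Rinv_0_lt_compat, pow_lt; lra. Qed.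

Lemma corner_step n :
  fst (corner n) <= fst (corner (S n)) <= fst (corner n) + a * half (S n) /\
  snd (corner n) <= snd (corner (S n)) <= snd (corner n) + b * half (S n).
Proof.
pose proof (half_pos (S n)).
assert (0 <= a * half (S n)) by nra; assert (0 <= b * half (S n)) by nra.
cbn [corner]; destruct (corner n) as [x y]; cbn [fst snd].
repeat destruct Rle_dec; cbn [fst snd]; lra.
Qed.

Lemma corner_nested n k :
  fst (corner n) <= fst (corner (n + k)) /\
  fst (corner (n + k)) + a * half (n + k) <= fst (corner n) + a * half n /\
  snd (corner n) <= snd (corner (n + k)) /\
  snd (corner (n + k)) + b * half (n + k) <= snd (corner n) + b * half n.
Proof.
induction k as [|k IH]; [rewrite Nat.add_0_r; lra|].
rewrite Nat.add_succ_r.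
pose proof (corner_step (n + k)); pose proof (half_S (n + k)). nra.
Qed.

Lemma diff_on_subrect n :
  diff_on_rect q (fst (corner n)) (fst (corner n) + a * half n)
    (snd (corner n)) (snd (corner n) + b * half n).
Proof.
intros x y Hx Hy; pose proof (corner_nested 0 n) as H.
assert (half 0 = 1) by (unfold half; simpl; lra).
simpl in H; rewrite !H0, !Rmult_1_r in H; apply Hq; lra.
Qed.

(** The circulations of the four quarters add up to that of the whole. If three of them fall short
    of a fourth, the last one, which [corner] takes without a test, must exceed it. *)
Lemma circ_corner n : circ_at n (corner n) / 4 <= circ_at (S n) (corner (S n)).
Proof.
pose proof (diff_on_subrect n) as D.
pose proof (half_pos (S n)); pose proof (half_S n) as E.
assert (0 <= a * half (S n)) by nra; assert (0 <= b * half (S n)) by nra.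
cbn [corner]; destruct (corner n) as [x y]; cbn [fst snd] in *.
destruct (Rle_dec _ (circ_at (S n) (x, y))) as [?|N1]; [assumption|].
destruct (Rle_dec _ (circ_at (S n) (x + a * half (S n), y))) as [?|N2]; [assumption|].
destruct (Rle_dec _ (circ_at (S n) (x, y + b * half (S n)))) as [?|N3]; [assumption|].
apply Rnot_le_lt in N1, N2, N3.
assert (S4 : circ_at n (x, y) <= circ_at (S n) (x, y)
  + circ_at (S n) (x + a * half (S n), y) + circ_at (S n) (x, y + b * half (S n))
  + circ_at (S n) (x + a * half (S n), y + b * half (S n))).
{ unfold circ_at; cbn [fst snd].
  rewrite E in *.
  replace (x + a * (2 * half (S n))) with (x + a * half (S n) + a * half (S n)) in * by ring.
  replace (y + b * (2 * half (S n))) with (y + b * half (S n) + b * half (S n)) in * by ring.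
  rewrite (circ_split_horizontal q x (x + a * half (S n))) by (trivial; lra).
  rewrite (circ_split_vertical q x (x + a * half (S n)) y (y + b * half (S n))),
    (circ_split_vertical q (x + a * half (S n)) _ y (y + b * half (S n)))
    by (try lra; intros u v Hu Hv; apply D; lra).
  repeat (eapply Rle_trans; [apply Rabs_triang|]).
  match goal with |- Rabs (?s + ?t) + Rabs (?u + ?v) <= _ =>
    pose proof (Rabs_triang s t); pose proof (Rabs_triang u v) end.
  lra. }
lra.
Qed.

Lemma circ_corner_0 n : circ_at 0 (x1, y1) * (half n * half n) <= circ_at n (corner n).
Proof.
induction n as [|n IH]; [replace (half 0 * half 0) with 1 by (unfold half; simpl; lra); simpl; lra|].
pose proof (circ_corner n); rewrite half_S in IH; lra.
Qed.

(** Nestedness puts every lower endpoint below every upper endpoint, so in each coordinate the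
    supremum of the lower endpoints lies in all the intervals. *)
Lemma corner_limit : exists x y, forall n,
  fst (corner n) <= x <= fst (corner n) + a * half n /\
  snd (corner n) <= y <= snd (corner n) + b * half n.
Proof.
assert (N : forall n m,
  fst (corner m) <= fst (corner n) + a * half n /\
  snd (corner m) <= snd (corner n) + b * half n).
{ intros n m; pose proof (half_pos n); pose proof (half_pos m).
  assert (0 <= a * half n /\ 0 <= a * half m /\ 0 <= b * half n /\ 0 <= b * half m)
    by (repeat split; nra).
  destruct (Nat.le_ge_cases n m) as [L|L]; apply Nat.le_exists_sub in L;
    destruct L as [k [-> _]]; rewrite Nat.add_comm in *.
  - pose proof (corner_nested n k); lra.
  - pose proof (corner_nested m k); lra. }
assert (L : forall f g : nat -> R, (forall n m, f m <= g n) ->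
  exists x, forall n, f n <= x <= g n).
{ intros f g H.
  destruct (completeness (fun r => exists n, r = f n)) as [x [Hu Hl]].
  - exists (g O); intros r [n ->]; apply H.
  - exists (f O); now exists O.
  - exists x; intros n; split; [apply Hu; now exists n|].
    apply Hl; intros r [m ->]; apply H. }
destruct (L (fun n => fst (corner n)) (fun n => fst (corner n) + a * half n)) as [x Hx];
  [intros; apply N|].
destruct (L (fun n => snd (corner n)) (fun n => snd (corner n) + b * half n)) as [y Hy];
  [intros; apply N|].
exists x, y; intros n; split; [apply Hx|apply Hy].
Qed.

(** The [n]-th rectangle keeps at least $4^{-n}$ of the circulation. Differentiability at the common
    point of the rectangles bounds what it keeps by an arbitrarily small multiple of $4^{-n}$. *)
Lemma circ_bisection_0 : circ_at 0 (x1, y1) = 0.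
Proof.
destruct corner_limit as [x [y Hxy]].
assert (H0 : half 0 = 1) by (unfold half; simpl; lra).
destruct (Hq x y) as [l Hl].
{ pose proof (Hxy O) as H; rewrite H0 in H; simpl in H; lra. }
{ pose proof (Hxy O) as H; rewrite H0 in H; simpl in H; lra. }
apply Rle_antisym; [|apply Rabs_pos].
apply le_epsilon; intros eps He; rewrite Rplus_0_l.
(* [s * half n] bounds both the distance to the limit point and the sum of the two sides of the
   [n]-th rectangle, whence $s^2$ in the tolerance; the 2 comes from [circ_estimate]. The added 1
   covers degenerate rectangles. *)
set (s := a + b + 1).
assert (Hs : 1 <= s) by (unfold s; lra).
assert (He' : 0 < eps / (2 * s * s)) by (apply Rdiv_lt_0_compat; nra).
destruct (proj1 (has_cderivE _ _ _) Hl _ He') as [d [Hd Hw]].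
destruct (pow_lt_1_zero (/ 2) ltac:(rewrite Rabs_pos_eq; lra) (d / s)
  ltac:(apply Rdiv_lt_0_compat; lra)) as [n Hn].
specialize (Hn n (le_n n)). rewrite pow_inv, <- (Rabs_pos_eq (/ 2 ^ n)) in Hn by
  (try (left; apply half_pos); lra).
rewrite Rabs_Rabsolu, Rabs_pos_eq in Hn by (left; apply half_pos).
fold (half n) in Hn.
pose proof (half_pos n) as Hp.
assert (Hsd : s * half n < d).
{ apply Rlt_le_trans with (s * (d / s)); [apply Rmult_lt_compat_l; lra|right; field; lra]. }
pose proof (circ_estimate q (fst (corner n)) (fst (corner n) + a * half n)
  (snd (corner n)) (snd (corner n) + b * half n) (x, y) l (eps / (2 * s * s) * (s * half n))
  (diff_on_subrect n) ltac:(nra) ltac:(nra)) as Est.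
assert (Hc : circ_at n (corner n) <= 2 * (eps / (2 * s * s) * (s * half n)) * (s * half n)).
{ eapply Rle_trans; [apply Est|].
  - intros u v Hu Hv.
    assert (B : Cmod ((u, v) - (x, y)) <= s * half n).
    { eapply Rle_trans; [apply Cmod_le_Rabs|]; simpl.
      pose proof (Hxy n).
      assert (Rabs (u + - x) <= a * half n) by (apply Rabs_le; lra).
      assert (Rabs (v + - y) <= b * half n) by (apply Rabs_le; lra).
      unfold s; lra. }
    eapply Rle_trans; [apply Hw; lra|]. apply Rmult_le_compat_l; lra.
  - apply Rmult_le_compat_l; [|unfold s; lra].
    apply Rmult_le_pos; [lra|]. apply Rmult_le_pos; [lra|nra]. }
pose proof (Rle_trans _ _ _ (circ_corner_0 n) Hc) as F.
replace (2 * (eps / (2 * s * s) * (s * half n)) * (s * half n))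
  with (eps * (half n * half n)) in F by (field; lra).
apply Rmult_le_reg_r in F; [exact F|nra].
Qed.

End Bisection.

Lemma circ_eq_0 (q : C -> C) (x1 x2 y1 y2 : R) :
  x1 <= x2 -> y1 <= y2 -> diff_on_rect q x1 x2 y1 y2 -> circ q x1 x2 y1 y2 = 0.
Proof.
intros Hx Hy Hq.
assert (E : forall u v, u + (v - u) = v) by (intros; ring).
pose proof (circ_bisection_0 q x1 y1 (x2 - x1) (y2 - y1) ltac:(lra) ltac:(lra)) as H.
rewrite !E in H; specialize (H Hq).
simpl in H; rewrite Rinv_1, !Rmult_1_r, !E in H.
destruct (Req_dec (circ q x1 x2 y1 y2) 0) as [?|N]; [assumption|].
now apply Rabs_no_R0 in N.
Qed.

(** * Vertical sections of the image *)

Lemma derive_pos_lt (f df : R -> R) (a b : R) :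
  a < b -> (forall t, a <= t <= b -> is_derive f t (df t)) ->
  (forall t, a <= t <= b -> 0 < df t) -> f a < f b.
Proof.
intros Hab Hd Hp.
destruct (MVT_gen f a b df) as [c [Hc E]]; rewrite ?Rmin_left, ?Rmax_right in * by lra.
- intros; apply Hd; lra.
- intros t Ht; apply derivable_continuous_pt; exists (df t); now apply is_derive_Reals, Hd.
- specialize (Hp c Hc); nra.
Qed.

Lemma RInt_le_const (f : R -> R) (a b M : R) :
  a <= b -> ex_RInt f a b -> (forall t, a <= t <= b -> f t <= M) ->
  RInt f a b <= (b - a) * M.
Proof.
intros Hab Hf HM.
replace ((b - a) * M) with (RInt (fun _ => M) a b)
  by (rewrite RInt_const; reflexivity).
apply RInt_le; trivial; [apply ex_RInt_const|intros; apply HM; lra].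
Qed.

Lemma RInt_ge_const (f : R -> R) (a b M : R) :
  a <= b -> ex_RInt f a b -> (forall t, a <= t <= b -> M <= f t) ->
  (b - a) * M <= RInt f a b.
Proof.
intros Hab Hf HM.
replace ((b - a) * M) with (RInt (fun _ => M) a b)
  by (rewrite RInt_const; reflexivity).
apply RInt_le; trivial; [apply ex_RInt_const|intros; apply HM; lra].
Qed.

Definition interval (J : R -> Prop) : Prop :=
  forall a b c, J a -> J b -> a <= c <= b -> J c.

Definition pos_deriv_on_strip (J : R -> Prop) (q dq : C -> C) : Prop :=
  forall x y, J x -> has_cderiv q (x, y) (dq (x, y)) /\ 0 < fst (dq (x, y)).

Lemma Im_increasing_vertical (J : R -> Prop) (q dq : C -> C) (x y1 y2 : R) :
  pos_deriv_on_strip J q dq -> J x -> y1 < y2 -> snd (q (x, y1)) < snd (q (x, y2)).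
Proof.
intros Hq Hx Hy.
apply (derive_pos_lt (fun y => snd (q (x, y))) (fun y => fst (dq (x, y)))); trivial.
- intros; now apply is_derive_Im_vertical, Hq.
- intros; now apply Hq.
Qed.

Lemma Re_nondecreasing_horizontal (J : R -> Prop) (q dq : C -> C) (x1 x2 y : R) :
  interval J -> pos_deriv_on_strip J q dq -> J x1 -> J x2 -> x1 <= x2 ->
  fst (q (x1, y)) <= fst (q (x2, y)).
Proof.
intros HJ Hq H1 H2 Hx.
destruct (Rle_lt_or_eq_dec _ _ Hx) as [Hlt| ->]; [left|right; reflexivity].
apply (derive_pos_lt (fun x => fst (q (x, y))) (fun x => fst (dq (x, y)))); trivial.
- intros; apply is_derive_Re_horizontal, Hq; now apply (HJ x1 x2).
- intros; apply Hq; now apply (HJ x1 x2).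
Qed.

(* With [U + iV = q], Cauchy's theorem gives [d/dx \int V(x, y) dy = U(x, v0) - U(x, v0 + T)]
   where [y] runs over [v0, v0 + T]. The second term is nonincreasing in [x] and the first does
   not depend on [T], so the mean of [V(x, .)] is concave in [x] up to an error [O(1/T)]. *)
Lemma Im_sup_concave (J : R -> Prop) (q dq : C -> C) (x1 x2 y1 y2 t : R) :
  interval J -> pos_deriv_on_strip J q dq -> J x1 -> J x2 -> x1 <= x2 -> 0 <= t <= 1 ->
  exists y, (1 - t) * snd (q (x1, y1)) + t * snd (q (x2, y2))
    <= snd (q ((1 - t) * x1 + t * x2, y)).
Proof.
intros HJ Hq J1 J2 H12 Ht.
set (x := (1 - t) * x1 + t * x2).
assert (Hx : x1 <= x <= x2) by (unfold x; nra).
assert (Jx : J x) by (now apply (HJ x1 x2)).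
assert (D : forall a b c d, x1 <= a -> b <= x2 -> diff_on_rect q a b c d).
{ intros a b c d Ha Hb u v Hu Hv; exists (dq (u, v)); apply Hq, (HJ x1 x2); trivial; lra. }
(* Starting strictly above both heights gains a margin [eta] in [V] at both ends. Over a height [T]
   this margin contributes [T * eta], which has to outweigh the fixed contribution [k] of the bottom
   edges. *)
set (v0 := Rmax y1 y2 + 1).
assert (HL : y1 < v0 /\ y2 < v0)
  by (pose proof (Rmax_l y1 y2); pose proof (Rmax_r y1 y2); unfold v0; lra).
destruct HL as [L1 L2]; apply (Im_increasing_vertical J q dq x1) in L1; trivial.
apply (Im_increasing_vertical J q dq x2) in L2; trivial.
set (eta := Rmin (snd (q (x1, v0)) - snd (q (x1, y1))) (snd (q (x2, v0)) - snd (q (x2, y2)))).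
assert (He : 0 < eta) by (apply Rmin_pos; lra).
assert (He1 : eta <= snd (q (x1, v0)) - snd (q (x1, y1))) by apply Rmin_l.
assert (He2 : eta <= snd (q (x2, v0)) - snd (q (x2, y2))) by apply Rmin_r.
set (b1 := RInt (fun s => fst (q (s, v0))) x1 x).
set (b2 := RInt (fun s => fst (q (s, v0))) x x2).
set (k := (1 - t) * b1 - t * b2).
(* Chosen so that [T * eta] is at least [- k]. The witness is the top height [v0 + T], where [V]
   dominates its mean over the vertical segment. *)
set (T := Rabs k / eta + 1).
assert (HT : 1 <= T).
{ assert (0 <= Rabs k / eta) by (apply Rdiv_le_0_compat; [apply Rabs_pos|lra]). unfold T; lra. }
assert (HTk : - k <= T * eta).
{ replace (T * eta) with (Rabs k + eta) by (unfold T; field; lra).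
  pose proof (Rle_abs (- k)); rewrite Rabs_Ropp in H; lra. }
exists (v0 + T).
pose proof (circ_eq_0 q x1 x v0 (v0 + T) ltac:(lra) ltac:(lra) ltac:(apply D; lra)) as C1.
pose proof (circ_eq_0 q x x2 v0 (v0 + T) ltac:(lra) ltac:(lra) ltac:(apply D; lra)) as C2.
unfold circ in C1, C2; fold b1 in C1; fold b2 in C2.
(* As [U] is nondecreasing along the top edge, its value above [x] separates the means over the left
   and right parts; the lengths of these parts are in the ratio [t] to [1 - t], which yields
   [top]. *)
set (U0 := fst (q (x, v0 + T))).
assert (T1 : RInt (fun s => fst (q (s, v0 + T))) x1 x <= (x - x1) * U0).
{ apply RInt_le_const; [lra| |].
  - apply (ex_RInt_horizontal q x1 x2 (v0 + T) (v0 + T)); try lra; apply D; lra.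
  - intros s Hs; apply (Re_nondecreasing_horizontal J q dq); trivial; try lra.
    apply (HJ x1 x2); trivial; lra. }
assert (T2 : (x2 - x) * U0 <= RInt (fun s => fst (q (s, v0 + T))) x x2).
{ apply RInt_ge_const; [lra| |].
  - apply (ex_RInt_horizontal q x1 x2 (v0 + T) (v0 + T)); try lra; apply D; lra.
  - intros s Hs; apply (Re_nondecreasing_horizontal J q dq); trivial; try lra.
    apply (HJ x1 x2); trivial; lra. }
assert (V : forall s, x1 <= s <= x2 -> J s ->
  T * snd (q (s, v0)) <= RInt (fun y => snd (q (s, y))) v0 (v0 + T) <= T * snd (q (s, v0 + T))).
{ intros s Hs Js.
  assert (M : forall u v, u <= v -> snd (q (s, u)) <= snd (q (s, v))).
  { intros u v Huv; destruct (Rle_lt_or_eq_dec _ _ Huv) as [Hlt| ->]; [left|right; reflexivity].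
    now apply (Im_increasing_vertical J q dq). }
  assert (E : ex_RInt (fun y => snd (q (s, y))) v0 (v0 + T))
    by (apply (ex_RInt_vertical q x1 x2 v0 (v0 + T)); try lra; apply D; lra).
  pose proof (RInt_ge_const _ v0 (v0 + T) (snd (q (s, v0))) ltac:(lra) E
    ltac:(intros y Hy; apply M; lra)) as E1.
  pose proof (RInt_le_const _ v0 (v0 + T) (snd (q (s, v0 + T))) ltac:(lra) E
    ltac:(intros y Hy; apply M; lra)) as E2.
  lra. }
pose proof (V x1 ltac:(lra) J1) as V1; pose proof (V x2 ltac:(lra) J2) as V2.
pose proof (V x Hx Jx) as [_ V3].
set (I1 := RInt (fun y => snd (q (x1, y))) v0 (v0 + T)) in *.
set (I2 := RInt (fun y => snd (q (x2, y))) v0 (v0 + T)) in *.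
set (I3 := RInt (fun y => snd (q (x, y))) v0 (v0 + T)) in *.
set (t1 := RInt (fun s => fst (q (s, v0 + T))) x1 x) in *.
set (t2 := RInt (fun s => fst (q (s, v0 + T))) x x2) in *.
assert (top : (1 - t) * t1 <= t * t2).
{ replace (x - x1) with (t * (x2 - x1)) in T1 by (unfold x; ring).
  replace (x2 - x) with ((1 - t) * (x2 - x1)) in T2 by (unfold x; ring).
  apply Rle_trans with ((1 - t) * (t * (x2 - x1) * U0)).
  - apply Rmult_le_compat_l; lra.
  - replace ((1 - t) * (t * (x2 - x1) * U0)) with (t * ((1 - t) * (x2 - x1) * U0)) by ring.
    apply Rmult_le_compat_l; lra. }
(* Each rectangle expresses [I3] through Cauchy's theorem; this is the average of the two
   expressions with weights [1 - t] and [t]. *)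
assert (E3 : I3 = (1 - t) * I1 + t * I2 + k - (1 - t) * t1 + t * t2).
{ assert (L : forall i1 i2 i3 c1 c2 s1 s2 : R,
    i3 - i1 + s1 - c1 = 0 -> i2 - i3 + s2 - c2 = 0 ->
    i3 = (1 - t) * i1 + t * i2 + ((1 - t) * c1 - t * c2) - (1 - t) * s1 + t * s2).
  { intros i1 i2 i3 c1 c2 s1 s2 A1 A2.
    replace s1 with (i1 - i3 + c1) by lra; replace s2 with (i3 - i2 + c2) by lra; ring. }
  exact (L _ _ _ _ _ _ _ C1 C2). }
assert (W1 : T * (snd (q (x1, y1)) + eta) <= I1)
  by (eapply Rle_trans; [|apply V1]; apply Rmult_le_compat_l; lra).
assert (W2 : T * (snd (q (x2, y2)) + eta) <= I2)
  by (eapply Rle_trans; [|apply V2]; apply Rmult_le_compat_l; lra).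
apply (Rmult_le_compat_l (1 - t)) in W1; [|lra].
apply (Rmult_le_compat_l t) in W2; [|lra].
apply Rmult_le_reg_l with T; [lra|].
eapply Rle_trans; [|apply V3]. rewrite E3. nra.
Qed.

Lemma has_cderiv_reflect (q : C -> C) (z l : C) :
  has_cderiv q (Complex.Cconj z) l ->
  has_cderiv (fun w => Complex.Cconj (q (Complex.Cconj w))) z (Complex.Cconj l).
Proof.
intros H; apply has_cderivE; intros eps He.
destruct (proj1 (has_cderivE _ _ _) H eps He) as [d [Hd Hw]].
exists d; split; trivial; intros w Hwz.
specialize (Hw (Complex.Cconj w)).
rewrite <- Cminus_conj, Cmod_conj in Hw.
specialize (Hw Hwz).
rewrite <- Cmod_conj, !Cminus_conj, Cmult_conj, !Cconj_conj, Cminus_conj.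
now rewrite <- Cminus_conj.
Qed.

(** The reflection $w\mapsto\overline{q(\overline w)}$ preserves the abscissa and the positivity of
    the real part of the derivative, and reverses the signs of [y] and of [V]. It turns the
    concavity result into this one. *)
Lemma Im_inf_convex (J : R -> Prop) (q dq : C -> C) (x1 x2 y1 y2 t : R) :
  interval J -> pos_deriv_on_strip J q dq -> J x1 -> J x2 -> x1 <= x2 -> 0 <= t <= 1 ->
  exists y, snd (q ((1 - t) * x1 + t * x2, y))
    <= (1 - t) * snd (q (x1, y1)) + t * snd (q (x2, y2)).
Proof.
intros HJ Hq J1 J2 H12 Ht.
destruct (Im_sup_concave J (fun w => Complex.Cconj (q (Complex.Cconj w)))
  (fun w => Complex.Cconj (dq (Complex.Cconj w))) x1 x2 (- y1) (- y2) t) as [y Hy]; trivial.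
- intros u v Hu; destruct (Hq u (- v) Hu) as [D P]; split; [|exact P].
  apply has_cderiv_reflect; exact D.
- exists (- y); unfold Complex.Cconj in Hy; simpl in Hy; rewrite !Ropp_involutive in Hy; lra.
Qed.

(** On the intermediate vertical line [V] takes a value above and a value below the weighted mean,
    hence the mean itself. The case [x2 < x1] follows by exchanging the endpoints. *)
Lemma Im_segment (J : R -> Prop) (q dq : C -> C) (x1 x2 y1 y2 t : R) :
  interval J -> pos_deriv_on_strip J q dq -> J x1 -> J x2 -> 0 <= t <= 1 ->
  exists y, snd (q ((1 - t) * x1 + t * x2, y))
    = (1 - t) * snd (q (x1, y1)) + t * snd (q (x2, y2)).
Proof.
intros HJ Hq.
assert (G : forall x1 x2 y1 y2 t, J x1 -> J x2 -> 0 <= t <= 1 -> x1 <= x2 ->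
  exists y, snd (q ((1 - t) * x1 + t * x2, y))
    = (1 - t) * snd (q (x1, y1)) + t * snd (q (x2, y2))).
{ clear x1 x2 y1 y2 t; intros x1 x2 y1 y2 t J1 J2 Ht H12.
  destruct (Im_sup_concave J q dq x1 x2 y1 y2 t) as [y' Hu]; trivial.
  destruct (Im_inf_convex J q dq x1 x2 y1 y2 t) as [y Hl]; trivial.
  assert (Jx : J ((1 - t) * x1 + t * x2)) by (apply (HJ x1 x2); trivial; nra).
  destruct (IVT_gen (fun y => snd (q ((1 - t) * x1 + t * x2, y))) y y'
    ((1 - t) * snd (q (x1, y1)) + t * snd (q (x2, y2)))) as [z [_ Hz]].
  - intros s; apply derivable_continuous_pt.
    eexists; apply is_derive_Reals, is_derive_Im_vertical, Hq, Jx.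
  - rewrite Rmin_left, Rmax_right; lra.
  - now exists z. }
intros J1 J2 Ht; destruct (Rle_or_lt x1 x2) as [H|H]; [now apply G|].
destruct (G x2 x1 y2 y1 (1 - t)) as [y Hy]; trivial; try lra.
exists y; replace ((1 - t) * x1 + t * x2) with ((1 - (1 - t)) * x2 + (1 - t) * x1) by ring.
rewrite Hy; ring.
Qed.

(** * Strip coordinates on the disk *)

Lemma Cmod_sqr (z : C) : Cmod z * Cmod z = fst z ^ 2 + snd z ^ 2.
Proof. unfold Cmod; rewrite sqrt_sqrt; [reflexivity|nra]. Qed.

Lemma Cmod_lt_sqr (z w : C) :
  Cmod z < Cmod w <-> fst z ^ 2 + snd z ^ 2 < fst w ^ 2 + snd w ^ 2.
Proof.
rewrite <- !Cmod_sqr; pose proof (Cmod_ge_0 z); pose proof (Cmod_ge_0 w).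
split; intros; nra.
Qed.

Lemma Cmult_conj_unit (z : C) : Cmod z = 1 -> (z * Complex.Cconj z)%C = RtoC 1.
Proof. intros H; rewrite <- Cmod2_conj, H; apply injective_projections; simpl; ring. Qed.

Lemma one_plus_unit_mult_neq_0 (u z : C) :
  Cmod u = 1 -> Cmod z < 1 -> (1 + u * z)%C <> RtoC 0.
Proof.
intros Hu Hz F; assert (G : Cmod (u * z)%C = 1).
{ replace (u * z)%C with (- (1))%C; [apply Cmod_m1|].
  symmetry; transitivity ((1 + u * z) - 1)%C; [ring|rewrite F; ring]. }
rewrite Cmod_mult, Hu in G; lra.
Qed.

(** In the upper half-plane [acos] alone yields the argument, because the sine is the positive
    square root. *)
Lemma polar_upper (z : C) :
  0 < snd z -> exists t, 0 < t < PI /\ z = (Cmod z * cos t, Cmod z * sin t).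
Proof.
intros Hz; pose proof (Cmod_sqr z) as E.
assert (Hr : 0 < Cmod z) by (pose proof (Cmod_ge_0 z); nra).
assert (S : (fst z / Cmod z)² = 1 - (snd z / Cmod z)²).
{ unfold Rsqr; field_simplify_eq; [nra|lra]. }
assert (P : 0 < snd z / Cmod z) by (now apply Rdiv_lt_0_compat).
assert (B : -1 < fst z / Cmod z < 1) by (unfold Rsqr in S; split; nra).
exists (acos (fst z / Cmod z)); split; [now apply acos_bound_lt|].
rewrite cos_acos, sin_acos by lra.
replace (1 - (fst z / Cmod z)²) with ((snd z / Cmod z)²) by lra.
rewrite sqrt_Rsqr by lra.
apply injective_projections; simpl; field; lra.
Qed.

(* [k] inverts a primitive of [c / ((1 + lam z) (1 + conj lam z))], which maps the disk onto a
   vertical strip, or onto a half-plane when [lam = 1] or [lam = -1]. *)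
Definition strip_chart (lam : C) (c : R) (J : R -> Prop) (k : C -> C) : Prop :=
  interval J /\ J 0 /\ k (0, 0) = RtoC 0 /\
  (forall x y, J x -> Cmod (k (x, y)) < 1 /\
     has_cderiv k (x, y) ((1 + lam * k (x, y)) * (1 + Complex.Cconj lam * k (x, y)) / c)%C) /\
  (forall z, Cmod z < 1 -> exists x y, J x /\ k (x, y) = z).

(** Both charts are brought to this shape, with [f] the identity or an exponential. The constant
    numerator leaves a single inversion to differentiate. *)
Lemma has_cderiv_moebius (a b c d : C) (f : C -> C) (z l : C) :
  (c - d * f z)%C <> RtoC 0 -> has_cderiv f z l ->
  has_cderiv (fun w => (a + b * / (c - d * f w))%C) z
    (b * d * l / ((c - d * f z) * (c - d * f z)))%C.
Proof.
intros Hn Hf.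
apply has_cderiv_ext with (fun w => (a + b * / (c + (- d) * f w))%C)
  (0 + b * (- / ((c + (- d) * f z) * (c + (- d) * f z)) * (0 + (- d) * l)))%C.
- intros w; replace (c + - d * f w)%C with (c - d * f w)%C by ring; reflexivity.
- replace (c + - d * f z)%C with (c - d * f z)%C by ring; field; exact Hn.
- apply has_cderiv_plus; [apply has_cderiv_const|apply has_cderiv_scal].
  apply (has_cderiv_comp (fun w => (/ w)%C) (fun w => (c + - d * f w)%C)).
  + apply has_cderiv_inv; replace (c + - d * f z)%C with (c - d * f z)%C by ring; exact Hn.
  + apply has_cderiv_plus; [apply has_cderiv_const|now apply has_cderiv_scal].
Qed.

(** Here [lam] is a sign $l$, the primitive $cz/(1+lz)$ has inverse $w/(c-lw)$, and [k] is this
    inverse with a constant numerator. *)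
Lemma strip_chart_real (lam : C) (c : R) :
  Cmod lam = 1 -> 0 < c -> snd lam = 0 -> exists J k, strip_chart lam c J k.
Proof.
intros Hl Hc Hs; destruct lam as [l l0]; simpl in Hs; subst l0.
assert (Hll : l * l = 1).
{ pose proof (Cmod_sqr (l, 0)) as E; rewrite Hl in E; simpl in E; lra. }
assert (Hcj : Complex.Cconj (l, 0) = ((l, 0) : C))
  by (apply injective_projections; simpl; ring).
change ((l, 0) : C) with (RtoC l) in *.
assert (Hlc : (RtoC l * RtoC l)%C = RtoC 1) by (rewrite <- RtoC_mult; now f_equal).
assert (Hc0 : RtoC c <> RtoC 0) by (intros E; apply RtoC_inj in E; lra).
set (k := fun w : C => (- RtoC l + RtoC c * RtoC l * / (RtoC c - RtoC l * w))%C).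
exists (fun x => 2 * l * x < c), k.
(* This says $|k|<1$. The difference of the squared moduli is $c(c-2lx)$, which is where the
   half-plane comes from. *)
assert (N : forall x y, 2 * l * x < c ->
  Cmod (x, y) < Cmod (RtoC c - RtoC l * (x, y))%C).
{ intros x y H; apply Cmod_lt_sqr; simpl.
  replace ((c + - (l * x - 0 * y)) * ((c + - (l * x - 0 * y)) * 1) +
    (0 + - (l * y + 0 * x)) * ((0 + - (l * y + 0 * x)) * 1))
    with (c * (c - 2 * l * x) + l * l * (x * x + y * y)) by ring.
  rewrite Hll; nra. }
assert (N0 : forall x y, 2 * l * x < c -> (RtoC c - RtoC l * (x, y))%C <> RtoC 0).
{ intros x y H; apply Cmod_gt_0; pose proof (Cmod_ge_0 (x, y)); specialize (N x y H); lra. }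
assert (E : forall w : C, (RtoC c - RtoC l * w)%C <> RtoC 0 ->
  k w = (w / (RtoC c - RtoC l * w))%C).
{ intros w Hw; unfold k; field_simplify_eq; [|exact Hw].
  transitivity ((RtoC l * RtoC l) * w)%C; [ring|rewrite Hlc; ring]. }
repeat split.
- intros a b x Ha Hb Hx; destruct (Rle_or_lt 0 l); nra.
- lra.
- unfold k; change ((0, 0) : C) with (RtoC 0); field_simplify_eq; [ring|].
  intros F; apply Hc0; rewrite <- F; ring.
- rewrite E by auto; rewrite Cmod_div by auto; specialize (N x y H).
  pose proof (Cmod_ge_0 (x, y)).
  apply Rlt_div_l; lra.
- rewrite Hcj.
  apply has_cderiv_ext with k
    (RtoC c * RtoC l * RtoC l * 1 / ((RtoC c - RtoC l * (x, y)) * (RtoC c - RtoC l * (x, y))))%C;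
    [reflexivity| |].
  + specialize (N0 x y H).
    replace (1 + RtoC l * k (x, y))%C with (RtoC c / (RtoC c - RtoC l * (x, y)))%C.
    * transitivity (RtoC c * (RtoC l * RtoC l) /
        ((RtoC c - RtoC l * (x, y)) * (RtoC c - RtoC l * (x, y))))%C;
        [field; exact N0|rewrite Hlc; field; split; assumption].
    * unfold k.
      transitivity ((1 - RtoC l * RtoC l) + RtoC l * RtoC l * (RtoC c / (RtoC c - RtoC l * (x, y))))%C;
        [rewrite Hlc|]; field; exact N0.
  + apply (has_cderiv_moebius (- RtoC l) (RtoC c * RtoC l) (RtoC c) (RtoC l) (fun w => w));
      [now apply N0|apply has_cderiv_id].
- intros z Hz.
  pose proof (one_plus_unit_mult_neq_0 (RtoC l) z Hl Hz) as Hd.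
  set (w := (RtoC c * z / (1 + RtoC l * z))%C).
  assert (Ew : (RtoC c - RtoC l * w)%C = (RtoC c / (1 + RtoC l * z))%C)
    by (unfold w; field; exact Hd).
  assert (Hdw : (RtoC c - RtoC l * w)%C <> RtoC 0).
  { rewrite Ew; intros F; apply Hc0.
    transitivity (RtoC c / (1 + RtoC l * z) * (1 + RtoC l * z))%C; [field; exact Hd|].
    rewrite F; ring. }
  assert (Ekw : k w = z).
  { rewrite E by exact Hdw; rewrite Ew; unfold w; field; split; assumption. }
  exists (fst w), (snd w); rewrite <- surjective_pairing; split; [|exact Ekw].
  assert (M : Cmod w < Cmod (RtoC c - RtoC l * w)%C).
  { rewrite Ew; unfold w; rewrite !Cmod_div, Cmod_mult by exact Hd.
    unfold Rdiv; apply Rmult_lt_compat_r; [apply Rinv_0_lt_compat, Cmod_gt_0, Hd|].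
    pose proof (proj1 (Cmod_gt_0 _) Hc0); nra. }
  apply Cmod_lt_sqr in M; destruct w as [x y]; simpl in *.
  replace ((c + - (l * x - 0 * y)) * ((c + - (l * x - 0 * y)) * 1) +
    (0 + - (l * y + 0 * x)) * ((0 + - (l * y + 0 * x)) * 1))
    with (c * (c - 2 * l * x) + l * l * (x * x + y * y)) in M by ring.
  rewrite Hll in M; nra.
Qed.

Lemma strip_chart_conj (lam : C) (c : R) (J : R -> Prop) (k : C -> C) :
  strip_chart (Complex.Cconj lam) c J k -> strip_chart lam c J k.
Proof.
intros (HJ & H0 & Hk & Hd & Hs); repeat split; trivial; intros; destruct (Hd x y H); trivial.
eapply has_cderiv_ext; [reflexivity| |eassumption].
rewrite Cconj_conj; f_equal; apply Cmult_comm.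
Qed.

(** The right-hand side is $4\,\mathrm{Im}\,\lambda\,\mathrm{Im}(\lambda\overline e)$. So for
    $\mathrm{Im}\,\lambda>0$ the map $(e-1)/(\lambda-\overline\lambda e)$ sends to the disk the
    half-plane that contains 1 and is bounded by the line through 0 and $\lambda$. *)
Lemma Moebius_norm_gap (lam e : C) :
  Cmod lam = 1 -> let D := (lam - Complex.Cconj lam * e)%C in
  (fst D ^ 2 + snd D ^ 2) - (fst (e - 1)%C ^ 2 + snd (e - 1)%C ^ 2)
    = 4 * snd lam * (snd lam * fst e - fst lam * snd e).
Proof.
intros H; pose proof (Cmod_sqr lam) as F; rewrite H in F.
destruct lam as [a b]; destruct e as [x y]; simpl in *.
transitivity ((a * (a * 1) + b * (b * 1) - 1) * (1 + x * x + y * y)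
  + 2 * x * (1 - (a * (a * 1) + b * (b * 1))) + 4 * b * (b * x - a * y));
  [ring|rewrite <- F; ring].
Qed.

(** Partial fractions give the primitive $\frac{c}{\lambda-\overline\lambda}\log\frac{1+\lambda
    z}{1+\overline\lambda z}$ with $\lambda-\overline\lambda=2i\,\mathrm{Im}\,\lambda$. Solving for
    the quotient gives $e=e^{isw}$ with $s=2\,\mathrm{Im}\,\lambda/c$, and then
    $z=(e-1)/(\lambda-\overline\lambda e)$. *)
Lemma strip_chart_upper (lam : C) (c : R) :
  Cmod lam = 1 -> 0 < c -> 0 < snd lam -> exists J k, strip_chart lam c J k.
Proof.
intros Hl Hc Hb.
destruct (polar_upper lam Hb) as [th [Hth El]].
rewrite Hl, !Rmult_1_l in El.
set (lam' := Complex.Cconj lam).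
assert (Hll : (lam * lam')%C = RtoC 1) by (now apply Cmult_conj_unit).
set (s := 2 * snd lam / c).
assert (Hs : 0 < s) by (apply Rdiv_lt_0_compat; lra).
assert (Hc0 : RtoC c <> RtoC 0) by (intros F; apply RtoC_inj in F; lra).
set (E := fun w => cexpi (RtoC s * w)%C).
set (k := fun w => (- lam + (lam * lam - 1) * / (lam - lam' * E w))%C).
(* [s * x] is an argument of [E (x, y)], and these are the arguments of the half-plane found in
   [Moebius_norm_gap]. *)
exists (fun x => th - PI < s * x < th), k.
pose proof (fun e => Moebius_norm_gap lam e Hl) as Gap; fold lam' in Gap.
assert (N : forall x y, th - PI < s * x < th ->
  Cmod (E (x, y) - 1)%C < Cmod (lam - lam' * E (x, y))%C).
{ intros x y H; apply Cmod_lt_sqr; specialize (Gap (E (x, y))); simpl in Gap |- *.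
  replace (s * x - 0 * y) with (s * x) in * by ring.
  set (r := exp _) in *.
  replace (snd lam * (r * cos (s * x)) - fst lam * (r * sin (s * x)))
    with (r * sin (th - s * x)) in Gap by (rewrite sin_minus, El; simpl; ring).
  assert (0 < r) by apply exp_pos.
  assert (0 < sin (th - s * x)) by (apply sin_gt_0; lra).
  assert (0 < 4 * snd lam * (r * sin (th - s * x)))
    by (repeat apply Rmult_lt_0_compat; lra).
  lra. }
assert (N0 : forall x y, th - PI < s * x < th -> (lam - lam' * E (x, y))%C <> RtoC 0).
{ intros x y H; apply Cmod_gt_0; pose proof (Cmod_ge_0 (E (x, y) - 1)%C).
  specialize (N x y H); lra. }
assert (K : forall w, (lam - lam' * E w)%C <> RtoC 0 ->
  k w = ((E w - 1) / (lam - lam' * E w))%C).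
{ intros w Hw; unfold k; field_simplify_eq; [|exact Hw].
  transitivity ((lam * lam') * E w - 1)%C; [ring|rewrite Hll; ring]. }
assert (E0 : E (0, 0) = RtoC 1).
{ unfold E, cexpi; simpl.
  replace (s * 0 - 0 * 0) with 0 by ring; replace (- (s * 0 + 0 * 0)) with 0 by ring.
  rewrite exp_0, cos_0, sin_0; apply injective_projections; simpl; ring. }
assert (Hdiff : (lam - lam')%C = (RtoC (2 * snd lam) * Ci)%C)
  by (apply injective_projections; simpl; ring).
assert (Hdiff0 : (lam - lam')%C <> RtoC 0).
{ rewrite Hdiff; apply Cmult_neq_0.
  - intros F; apply RtoC_inj in F; lra.
  - intros F; apply (f_equal snd) in F; simpl in F; lra. }
assert (J0 : th - PI < s * 0 < th) by lra.
repeat split.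
- pose proof (Rmult_le_compat_l s a c0); pose proof (Rmult_le_compat_l s c0 b); lra.
- pose proof (Rmult_le_compat_l s a c0); pose proof (Rmult_le_compat_l s c0 b); lra.
- lra.
- lra.
- rewrite K by (now apply N0); rewrite E0; field.
  replace (lam - lam' * 1)%C with (lam - lam')%C by ring; exact Hdiff0.
- rewrite K by auto; rewrite Cmod_div by auto; specialize (N x y H).
  pose proof (Cmod_ge_0 (E (x, y) - 1)%C).
  apply Rlt_div_l; lra.
- set (w := ((x, y) : C)); assert (Hw : (lam - lam' * E w)%C <> RtoC 0) by (now apply N0).
  apply has_cderiv_ext with k
    ((lam * lam - 1) * lam' * (E w * Ci * (RtoC s * 1)) / ((lam - lam' * E w) * (lam - lam' * E w)))%C;
    [reflexivity| |].
  + fold lam'.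
    assert (A1 : (1 + lam * k w)%C = ((lam - lam') * E w / (lam - lam' * E w))%C).
    { rewrite K by exact Hw; field; exact Hw. }
    assert (A2 : (1 + lam' * k w)%C = ((lam - lam') / (lam - lam' * E w))%C).
    { rewrite K by exact Hw; field; exact Hw. }
    rewrite A1, A2.
    assert (A3 : ((lam * lam - 1) * lam')%C = (lam - lam')%C).
    { transitivity (lam * (lam * lam') - lam')%C; [ring|rewrite Hll; ring]. }
    assert (A4 : RtoC s = (RtoC (2 * snd lam) / RtoC c)%C).
    { unfold s; rewrite RtoC_div; [reflexivity|lra]. }
    rewrite A3, A4.
    transitivity ((lam - lam') * (RtoC (2 * snd lam) * Ci) * E w /
      (RtoC c * ((lam - lam' * E w) * (lam - lam' * E w))))%C;
      [|rewrite <- Hdiff]; field; split; assumption.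
  + apply (has_cderiv_moebius (- lam) (lam * lam - 1) lam lam' E); [exact Hw|].
    apply (has_cderiv_comp cexpi (fun w => (RtoC s * w)%C)); [apply has_cderiv_cexpi|].
    apply has_cderiv_scal, has_cderiv_id.
- intros z Hz.
  pose proof (one_plus_unit_mult_neq_0 lam z Hl Hz) as Hn1.
  pose proof (one_plus_unit_mult_neq_0 lam' z
    ltac:(unfold lam'; now rewrite Cmod_conj) Hz) as Hn2.
  set (e := ((1 + lam * z) / (1 + lam' * z))%C).
  assert (D1 : (e - 1)%C = ((lam - lam') / (1 + lam' * z) * z)%C)
    by (unfold e; field; exact Hn2).
  assert (D2 : (lam - lam' * e)%C = ((lam - lam') / (1 + lam' * z))%C).
  { unfold e; field_simplify_eq; [|exact Hn2]. ring. }
  assert (D20 : ((lam - lam') / (1 + lam' * z))%C <> RtoC 0).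
  { intros F; apply Hdiff0.
    transitivity ((lam - lam') / (1 + lam' * z) * (1 + lam' * z))%C; [field; exact Hn2|].
    rewrite F; ring. }
  assert (M : Cmod (e - 1)%C < Cmod (lam - lam' * e)%C).
  { rewrite D1, D2, Cmod_mult. pose proof (proj1 (Cmod_gt_0 _) D20); nra. }
  apply Cmod_lt_sqr in M; pose proof (Gap e) as G; cbv zeta in G.
  assert (P : 0 < snd lam * fst e - fst lam * snd e)
    by (apply Rmult_lt_reg_l with (4 * snd lam); lra).
  (* This product lies in the upper half-plane, so its argument [al] is between 0 and [PI]. The
     argument [th - al] of [e] then lies in the required range without any choice of branch. *)
  destruct (polar_upper (lam * Complex.Cconj e)%C) as [al [Hal Ea]].
  { change (0 < fst lam * - snd e + snd lam * fst e); lra. }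
  rewrite Cmod_mult, Hl, Cmod_conj, Rmult_1_l in Ea.
  assert (Hr : 0 < Cmod e).
  { apply Cmod_gt_0; intros F; rewrite F in P; simpl in P; lra. }
  set (r := Cmod e) in *.
  exists ((th - al) / s), (- ln r / s).
  assert (Es : s * ((th - al) / s) = th - al) by (field; lra).
  split; [rewrite Es; lra|].
  assert (Ee : E ((th - al) / s, - ln r / s) = e).
  { assert (Ee' : e = (lam * Complex.Cconj (lam * Complex.Cconj e))%C).
    { rewrite Cmult_conj, Cconj_conj; fold lam'.
      transitivity ((lam * lam') * e)%C; [rewrite Hll; ring|ring]. }
    rewrite Ee', Ea, El; unfold E, cexpi; simpl.
    replace (s * ((th - al) / s) - 0 * (- ln r / s)) with (th - al) by (field; lra).
    replace (- (s * (- ln r / s) + 0 * ((th - al) / s))) with (ln r) by (field; lra).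
    rewrite exp_ln, cos_minus, sin_minus by exact Hr.
    apply injective_projections; simpl; ring. }
  rewrite K by (rewrite Ee, D2; exact D20).
  rewrite Ee, D1, D2; field; split; assumption.
Qed.

Lemma exists_strip_chart (lam : C) (c : R) :
  Cmod lam = 1 -> 0 < c -> exists J k, strip_chart lam c J k.
Proof.
intros Hl Hc; destruct (Rtotal_order (snd lam) 0) as [H|[H|H]].
- destruct (strip_chart_upper (Complex.Cconj lam) c) as (J & k & Hk).
  + now rewrite Cmod_conj.
  + exact Hc.
  + simpl; lra.
  + exists J, k; now apply strip_chart_conj.
- now apply strip_chart_real.
- now apply strip_chart_upper.
Qed.

(** * Convex harmonic mappings *)

(** Only the real part is wanted, so the real mean value theorem on the segment from the origin
    suffices; the segment stays in the strip because [J] is an interval containing 0. *)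
Lemma Re_identity_on_strip (J : R -> Prop) (p : C -> C) :
  interval J -> J 0 -> p (0, 0) = RtoC 0 ->
  (forall x y, J x -> has_cderiv p (x, y) (RtoC 1)) ->
  forall x y, J x -> fst (p (x, y)) = x.
Proof.
intros HJ H0 Hp Hd x y Hx.
assert (E : forall s, (RtoC 0 + RtoC s * (x, y))%C = ((s * x, s * y) : C))
  by (intros s; apply injective_projections; simpl; ring).
assert (D : forall s, 0 <= s <= 1 ->
  is_derive (fun s => fst (p (RtoC 0 + RtoC s * (x, y))%C)) s x).
{ intros s Hs.
  assert (L : has_cderiv p (RtoC 0 + RtoC s * (x, y))%C (RtoC 1)).
  { rewrite E; apply Hd.
    destruct (Rle_or_lt 0 x); [apply (HJ 0 x)|apply (HJ x 0)]; trivial; nra. }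
  apply is_derive_along in L; destruct L as [L _].
  replace (fst (RtoC 1 * (x, y))%C) with x in L by (simpl; ring); exact L. }
destruct (MVT_gen (fun s => fst (p (RtoC 0 + RtoC s * (x, y))%C)) 0 1 (fun _ => x))
  as [s [_ Hs]]; rewrite ?Rmin_left, ?Rmax_right by lra.
- intros s Hs; apply D; lra.
- intros s Hs; apply derivable_continuous_pt; exists x; now apply is_derive_Reals, D.
- rewrite !E, !Rmult_0_l, !Rmult_1_l, Hp in Hs; simpl in Hs; lra.
Qed.

(** With $k=1/(a+b)$, the real part of $(a-b)/(a+b)$ is $(|a|^2-|b|^2)|k|^2$. *)
Lemma Re_cayley_pos (a b k : C) :
  ((a + b) * k)%C = RtoC 1 -> Cmod b < Cmod a -> 0 < fst ((a - b) * k)%C.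
Proof.
intros H Hab; apply Cmod_lt_sqr in Hab.
assert (Hk : k = (Complex.Cconj (a + b) * (k * Complex.Cconj k))%C).
{ transitivity (k * Complex.Cconj ((a + b) * k))%C.
  - rewrite H; apply injective_projections; simpl; ring.
  - rewrite Cmult_conj; ring. }
assert (Hk0 : 0 < fst k ^ 2 + snd k ^ 2).
{ rewrite <- Cmod_sqr.
  assert (0 < Cmod k); [|nra].
  apply Cmod_gt_0; intros F; rewrite F, Cmult_0_r in H; apply RtoC_inj in H; lra. }
rewrite Hk; destruct a as [a1 a2], b as [b1 b2], k as [k1 k2]; simpl in *.
match goal with |- 0 < ?e =>
  replace e with ((a1 * (a1 * 1) + a2 * (a2 * 1) - (b1 * (b1 * 1) + b2 * (b2 * 1)))
    * (k1 * (k1 * 1) + k2 * (k2 * 1))) by ring end.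
apply Rmult_lt_0_compat; lra.
Qed.

Lemma rotated_harm_chart (lam b : C) (c : R) (h h' g g' : C -> C)
  (J : R -> Prop) (k : C -> C) :
  Cmod lam = 1 -> Cmod b = 1 -> 0 < c ->
  analytic_on_disk h h' -> analytic_on_disk g g' ->
  h (RtoC 0) = RtoC 0 -> g (RtoC 0) = RtoC 0 ->
  (forall z : C, Cmod z < 1 ->
     (h' z + Complex.Cconj b * Complex.Cconj b * g' z)%C
     = (c / ((1 + lam * (b * z)) * (1 + Complex.Cconj lam * (b * z))))%C) ->
  (forall z : C, Cmod z < 1 -> Cmod (g' z) < Cmod (h' z)) ->
  strip_chart lam c J k ->
  exists q dq, pos_deriv_on_strip J q dq /\
    forall x y, J x ->
      harm h g (Complex.Cconj b * k (x, y))%C = (Complex.Cconj b * (x, snd (q (x, y))))%C.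
Proof.
intros Hlam Hb Hc Hh Hg h0 g0 Heq Hsp (HJ & J0 & k0 & Hk & _).
set (b' := Complex.Cconj b) in *.
assert (Hb' : Cmod b' = 1) by (unfold b'; now rewrite Cmod_conj).
assert (Hbb : (b * b')%C = RtoC 1) by (now apply Cmult_conj_unit).
set (K := fun w => (b' * k w)%C).
set (A := fun w => ((1 + lam * k w) * (1 + Complex.Cconj lam * k w))%C).
set (q := fun w => (b * h (K w) + - b' * g (K w))%C).
set (p := fun w => (b * h (K w) + b' * g (K w))%C).
set (dq := fun w => ((h' (K w) - b' * b' * g' (K w)) * (A w / c))%C).
assert (Hc0 : RtoC c <> RtoC 0) by (intros F; apply RtoC_inj in F; lra).
assert (HK : forall x y, J x -> Cmod (K (x, y)) < 1).
{ intros x y Hx; unfold K; rewrite Cmod_mult, Hb', Rmult_1_l; now apply Hk. }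
assert (HbK : forall w, (b * K w)%C = k w).
{ intros w; unfold K; transitivity ((b * b') * k w)%C; [ring|rewrite Hbb; ring]. }
(* The derivative of [K] is [b' * (A / c)], so the equation defining the class says precisely that
   [p] has derivative 1 in the strip coordinate. *)
assert (Hsum : forall x y, J x ->
  ((h' (K (x, y)) + b' * b' * g' (K (x, y))) * (A (x, y) / c))%C = RtoC 1).
{ intros x y Hx; rewrite Heq by (now apply HK).
  rewrite HbK; unfold A; destruct (Hk x y Hx) as [Hk1 _].
  field; repeat split; trivial; apply one_plus_unit_mult_neq_0; trivial; now rewrite Cmod_conj. }
assert (DK : forall x y, J x -> has_cderiv K (x, y) (b' * (A (x, y) / c))%C)
  by (intros x y Hx; apply has_cderiv_scal, Hk, Hx).
assert (Dh : forall x y, J x -> has_cderiv (fun w => h (K w)) (x, y)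
    (h' (K (x, y)) * (b' * (A (x, y) / c)))%C).
{ intros x y Hx; apply has_cderiv_comp; [apply Hh, HK, Hx|now apply DK]. }
assert (Dg : forall x y, J x -> has_cderiv (fun w => g (K w)) (x, y)
    (g' (K (x, y)) * (b' * (A (x, y) / c)))%C).
{ intros x y Hx; apply has_cderiv_comp; [apply Hg, HK, Hx|now apply DK]. }
exists q, dq; split.
- intros x y Hx; split.
  + eapply has_cderiv_ext; [reflexivity| |
      apply has_cderiv_plus; apply has_cderiv_scal; [now apply Dh|now apply Dg]].
    unfold dq; set (H := h' _); set (G := g' _); set (B := (A (x, y) / c)%C).
    transitivity ((b * b') * H * B - b' * b' * G * B)%C; [ring|rewrite Hbb; ring].
  + apply Re_cayley_pos; [now apply Hsum|].
    rewrite !Cmod_mult, Hb', !Rmult_1_l; apply Hsp, HK, Hx.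
- intros x y Hx.
  assert (Hp : fst (p (x, y)) = x).
  { apply (Re_identity_on_strip J); trivial.
    - unfold p, K; rewrite k0, Cmult_0_r, h0, g0; ring.
    - intros u v Hu.
      eapply has_cderiv_ext; [reflexivity| |
        apply has_cderiv_plus; apply has_cderiv_scal; [now apply Dh|now apply Dg]].
      rewrite <- (Hsum u v Hu).
      set (H := h' _); set (G := g' _); set (B := (A (u, v) / c)%C).
      transitivity ((b * b') * H * B + b' * b' * G * B)%C; [ring|rewrite Hbb; ring]. }
  change (h (K (x, y)) + Complex.Cconj (g (K (x, y))) = b' * (x, snd (q (x, y))))%C.
  (* The numbers $b\overline g$ and $\overline b g$ are conjugate: they share their real part, which
     gives [p], and have opposite imaginary parts, which gives the minus sign in [q]. *)
  replace ((x, snd (q (x, y))) : C)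
    with (b * (h (K (x, y)) + Complex.Cconj (g (K (x, y)))))%C.
  + transitivity ((b * b') * (h (K (x, y)) + Complex.Cconj (g (K (x, y)))))%C;
      [rewrite Hbb; ring|ring].
  + rewrite <- Hp at 3; unfold p, q, b'.
    apply injective_projections; simpl; ring.
Qed.

Lemma convex_harmonic_of_chart (lam b : C) (c : R) (h g : C -> C)
  (J : R -> Prop) (k q dq : C -> C) :
  Cmod b = 1 -> strip_chart lam c J k -> pos_deriv_on_strip J q dq ->
  (forall x y, J x ->
     harm h g (Complex.Cconj b * k (x, y))%C = (Complex.Cconj b * (x, snd (q (x, y))))%C) ->
  univalent_on_disk (harm h g) /\ convex_image (harm h g).
Proof.
intros Hb (HJ & _ & _ & Hk & Hs) Hq HF.
set (b' := Complex.Cconj b) in *.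
assert (Hb' : Cmod b' = 1) by (unfold b'; now rewrite Cmod_conj).
assert (Hbb : (b * b')%C = RtoC 1) by (now apply Cmult_conj_unit).
(* Every point of the disk has strip coordinates after the rotation by [b], so both claims can be
   checked on points of the strip. *)
assert (Hz : forall z : C, Cmod z < 1 -> exists x y, J x /\ z = (b' * k (x, y))%C).
{ intros z Hz; destruct (Hs (b * z)%C) as (x & y & Hx & E).
  - rewrite Cmod_mult, Hb; lra.
  - exists x, y; split; trivial; rewrite E.
    transitivity ((b * b') * z)%C; [rewrite Hbb; ring|ring]. }
split.
- intros z w Hz1 Hw1.
  destruct (Hz z Hz1) as (x & y & Jx & ->), (Hz w Hw1) as (u & v & Ju & ->).
  rewrite !HF by assumption; intros E.
  assert (E' : @eq C (x, snd (q (x, y))) (u, snd (q (u, v)))).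
  { transitivity (b * (b' * (x, snd (q (x, y)))))%C; [now rewrite Cmult_assoc, Hbb, Cmult_1_l|].
    now rewrite E, Cmult_assoc, Hbb, Cmult_1_l. }
  injection E' as -> E2.
  destruct (Rtotal_order y v) as [H|[->|H]]; [|reflexivity|];
    apply (Im_increasing_vertical J q dq u) in H; trivial; lra.
- intros z w Hz1 Hw1 t Ht.
  destruct (Hz z Hz1) as (x & y & Jx & ->), (Hz w Hw1) as (u & v & Ju & ->).
  destruct (Im_segment J q dq x u y v t) as [s Es]; trivial.
  assert (Jt : J ((1 - t) * x + t * u)).
  { destruct (Rle_or_lt x u); [apply (HJ x u)|apply (HJ u x)]; trivial; nra. }
  set (r := (1 - t) * x + t * u) in *.
  exists (b' * k (r, s))%C; split.
  + change (Cmod (b' * k (r, s))%C < 1).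
    rewrite Cmod_mult, Hb', Rmult_1_l; now apply Hk.
  + rewrite !HF by assumption; rewrite Es; unfold r.
    apply injective_projections; simpl; ring.
Qed.

(* Restores the names shadowed by Coquelicot, such as [Cconj]. *)
Import Defs.

Theorem theorem3 (lam del a : Cx) (gamma : R) (h h' g g' : Cx -> Cx) :
  on_circle lam -> on_circle del -> in_disk a ->
  is_arg (Cadd Cone (Cconj a)) gamma ->
  in_classF lam del a gamma h h' g g' ->
  sense_preserving h' g' ->
  univalent_on_disk (harm h g) /\ convex_image (harm h g).
Proof.
intros Hlam Hdel Ha _ [(Hh & Hg & h0 & g0 & _) Heq] Hsp.
set (c := Cnorm (Cadd Cone a)).
(* The numerator $1+a'$ is $|1+a|$, positive because $|a|<1$ excludes $a=-1$. *)
assert (Hc : 0 < c).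
{ change (0 < Cmod (1 + a)%C).
  apply Cmod_gt_0; rewrite <- (Cmult_1_l a).
  apply one_plus_unit_mult_neq_0; [apply Cmod_1|exact Ha]. }
assert (He : Cmod (Cexpi gamma) = 1).
{ transitivity (sqrt 1); [unfold Cmod; simpl; f_equal|apply sqrt_1].
  pose proof (sin2_cos2 gamma); unfold Rsqr in *; lra. }
set (b := (del * Cexpi gamma)%C).
assert (Hb : Cmod b = 1).
{ unfold b; rewrite Cmod_mult, He; change (Cnorm del * 1 = 1); rewrite Hdel; ring. }
(* This turns the coefficient of [g'] into the square of the conjugate of [b]. *)
assert (He2 : Cexpi (-2 * gamma)
  = (Complex.Cconj (Cexpi gamma) * Complex.Cconj (Cexpi gamma))%C).
{ unfold Cexpi; replace (-2 * gamma) with (- gamma + - gamma) by ring.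
  rewrite cos_plus, sin_plus, cos_neg, sin_neg.
  apply injective_projections; simpl; ring. }
destruct (exists_strip_chart lam c Hlam Hc) as (J & k & Hk).
destruct (rotated_harm_chart lam b c h h' g g' J k) as (q & dq & Hq & HF); trivial.
- intros z Hz; specialize (Heq z Hz).
  replace (1 + (Cnorm (Cadd Cone a) - 1)) with c in Heq by (unfold c; ring).
  rewrite He2 in Heq.
  unfold b; rewrite Cmult_conj.
  etransitivity; [etransitivity; [|exact Heq]|].
  + change (h' z + Complex.Cconj del * Complex.Cconj (Cexpi gamma)
      * (Complex.Cconj del * Complex.Cconj (Cexpi gamma)) * g' z
      = h' z + Complex.Cconj del * Complex.Cconj del
      * (Complex.Cconj (Cexpi gamma) * Complex.Cconj (Cexpi gamma)) * g' z)%C.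
    ring.
  + change (Coquelicot.Complex.RtoC c / ((1 + lam * del * Cexpi gamma * z)
        * (1 + Complex.Cconj lam * del * Cexpi gamma * z))
      = Coquelicot.Complex.RtoC c / ((1 + lam * (del * Cexpi gamma * z))
        * (1 + Complex.Cconj lam * (del * Cexpi gamma * z))))%C.
    now rewrite !Cmult_assoc.
- now apply (convex_harmonic_of_chart lam b c h g J k q dq).
Qed.
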